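(* Let $L>0$. Let $F:\mathbb{R}^n\to\mathbb{R}^n$ be $L$-Lipschitz, let $A:\mathbb{R}^n\rightrightarrows\mathbb{R}^n$ be maximally monotone, suppose $F+A$ is monotone, and suppose $\mathrm{Zer}(F+A)\neq\emptyset$. Let $\eta\in(0,\frac1L)$, let $z_0=w_0\in\mathbb{R}^n$, let $\{z_k\}_{k\ge0}$ be the iterates of composite-FEG (with parameter $\rho=0$ and step size $\eta$) and let $\{w_k\}_{k\ge0}$ be the iterates of OHM (with the same $\eta$). Let $H_0^2=\min_{z^*\in\mathrm{Zer}(F+A)}\|z_0-z^*\|^2$. Then for every integer $k\ge1$, $$\|z_{k+1}-w_{k+1}\|^2\le\frac{H_0^2}{1-\eta^2L^2}\cdot\left(\frac{24}{(k+1)^{\frac12}}+\frac{36}{(k+1)^2}\right).$$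
   Context: $\mathbb{R}^n$ carries the Euclidean inner product $\langle\cdot,\cdot\rangle$ and norm $\|\cdot\|$. A set-valued operator $E:\mathbb{R}^n\rightrightarrows\mathbb{R}^n$ is monotone if $\langle u-u',z-z'\rangle\ge0$ for all $z,z'$ and all $u\in E(z)$, $u'\in E(z')$, and maximally monotone if moreover its graph is not strictly contained in the graph of another monotone operator. $(F+A)(z)=\{F(z)+c: c\in A(z)\}$, $\mathrm{Zer}(F+A)=\{z:0\in F(z)+A(z)\}$. The resolvent of an operator $B$ with parameter $\eta>0$ is $J_{\eta B}=(I+\eta B)^{-1}$; under the stated hypotheses both $J_{\eta A}$ and $J_{\eta(F+A)}$ are single-valued and defined on all of $\mathbb{R}^n$. Put $\beta_k=\frac1{k+1}$. composite-FEG with parameter $\rho=0$: $c_0=0$ and for $k\ge0$ $$z_{k+\frac12}=\beta_kz_0+(1-\beta_k)z_k-(1-\beta_k)\eta(F(z_k)+c_k),$$ $$z_{k+1}=J_{\eta A}\big[\beta_kz_0+(1-\beta_k)z_k-\eta F(z_{k+\frac12})\big],$$ $$c_{k+1}=\frac{\beta_kz_0+(1-\beta_k)z_k-\eta F(z_{k+\frac12})-z_{k+1}}{\eta}.$$ OHM (optimized Halpern's method): for $k\ge0$, $w_{k+\frac12}=\beta_kw_0+(1-\beta_k)w_k$ and $w_{k+1}=J_{\eta(F+A)}[w_{k+\frac12}]$. *)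

(* Defs.v *)
From HB Require Import structures.
From mathcomp Require Import all_boot all_order all_algebra.
From mathcomp Require Import all_classical all_reals.

Set Implicit Arguments.
Unset Strict Implicit.
Unset Printing Implicit Defensive.

Import Order.TTheory GRing.Theory Num.Theory.

Local Open Scope classical_set_scope.
Local Open Scope ring_scope.

(* The norm that MathComp-Analysis puts on 'rV[R]_n is the sup norm, so the
   Euclidean structure is defined here. *)
Definition dotv (R : realType) (n : nat) (u v : 'rV[R]_n) : R :=
  \sum_(i < n) u 0 i * v 0 i.

Definition enorm (R : realType) (n : nat) (u : 'rV[R]_n) : R :=
  Num.sqrt (dotv u u).

Definition elipschitz (R : realType) (n : nat) (L : R)
    (F : 'rV[R]_n -> 'rV[R]_n) : Prop :=
  forall x y, enorm (F x - F y) <= L * enorm (x - y).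

(* A set-valued operator E : R^n => R^n; [E z u] means u \in E(z). *)
Definition operator (R : realType) (n : nat) := 'rV[R]_n -> set 'rV[R]_n.

Definition graph (R : realType) (n : nat) (E : operator R n) :
    set ('rV[R]_n * 'rV[R]_n) :=
  [set p | E p.1 p.2].

Definition monotone_op (R : realType) (n : nat) (E : operator R n) : Prop :=
  forall z z' u u', E z u -> E z' u' -> 0 <= dotv (u - u') (z - z').

Definition maximal_monotone_op (R : realType) (n : nat) (E : operator R n) :
    Prop :=
  monotone_op E /\
  ~ (exists E' : operator R n, monotone_op E' /\ graph E `<` graph E').

Definition addop (R : realType) (n : nat) (F : 'rV[R]_n -> 'rV[R]_n)
    (A : operator R n) : operator R n :=
  fun z => [set F z + c | c in A z].

Definition scaleop (R : realType) (n : nat) (eta : R) (B : operator R n) :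
    operator R n :=
  fun z => [set eta *: b | b in B z].

Definition invop (R : realType) (n : nat) (E : operator R n) : operator R n :=
  fun x => [set z | E z x].

Definition zer (R : realType) (n : nat) (E : operator R n) : set 'rV[R]_n :=
  [set z | E z 0].

(* The resolvent (I + eta B)^{-1}, as a set-valued operator; where it is
   single-valued, [resolvent eta B x z] reads z = J_{eta B}[x]. *)
Definition resolvent (R : realType) (n : nat) (eta : R) (B : operator R n) :
    operator R n :=
  invop (addop id (scaleop eta B)).

Definition beta (R : realType) (k : nat) : R := k.+1%:R^-1.

(* [zh k] and [wh k] below stand for the half-step iterates z_{k+1/2} and
   w_{k+1/2}. *)
Definition composite_FEG (R : realType) (n : nat) (eta : R)
    (F : 'rV[R]_n -> 'rV[R]_n) (A : operator R n)
    (z zh c : nat -> 'rV[R]_n) : Prop :=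
  c 0%N = 0 /\
  forall k : nat,
    [/\ zh k = beta R k *: z 0%N + (1 - beta R k) *: z k
               - ((1 - beta R k) * eta) *: (F (z k) + c k),
        resolvent eta A
          (beta R k *: z 0%N + (1 - beta R k) *: z k - eta *: F (zh k))
          (z k.+1)
      & c k.+1 = eta^-1 *: (beta R k *: z 0%N + (1 - beta R k) *: z k
                            - eta *: F (zh k) - z k.+1)].

Definition OHM (R : realType) (n : nat) (eta : R)
    (F : 'rV[R]_n -> 'rV[R]_n) (A : operator R n)
    (w wh : nat -> 'rV[R]_n) : Prop :=
  forall k : nat,
    wh k = beta R k *: w 0%N + (1 - beta R k) *: w k /\
    resolvent eta (addop F A) (wh k) (w k.+1).

Definition is_min (R : realType) (S : set R) (m : R) : Prop :=
  S m /\ lbound S m.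

(* Main.v *)
Require Import Defs.
From HB Require Import structures.
From mathcomp Require Import all_boot all_order all_algebra.
From mathcomp Require Import all_classical all_reals.
From mathcomp Require Import ring lra.

Set Implicit Arguments.
Unset Strict Implicit.
Unset Printing Implicit Defensive.

Import Order.TTheory GRing.Theory Num.Theory.

Local Open Scope classical_set_scope.
Local Open Scope ring_scope.

(** Composite-FEG is OHM run with errors, and the errors are small enough to
    be summed.  Write [T = F + A], [x_k = beta_k z_0 + (1 - beta_k) z_k],
    [g_k = eta (F z_k + c_k)], [D_k = z_{k+1} - z_{k+1/2}] and
    [e_k = eta (F z_{k+1} - F z_{k+1/2})].  Since [c_{k+1}] lies in
    [A z_{k+1}], the implicit step reads [z_{k+1} = J_{eta T} (x_k + e_k)]
    ([resolvent_addop]), whereas OHM applies [J_{eta T}] to the anchored point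
    without the error.

    Nonexpansiveness of the resolvent gives
    [|(k+1)(z_{k+1} - w_{k+1})| <= |k (z_k - w_k) + (k+1) e_k|].  Unrolling
    this and using convexity of the square yields
    [|k (z_k - w_k)|^2 <= k \sum_(j < k) |(j+1) e_j|^2] ([FEG_OHM_drift]), so a
    bound on the weighted sum of squared errors is all that is needed.

    That bound comes from the energy
    [V_k = k <g_k, z_0 - z_k> - k^2/2 |g_k|^2].  Monotonicity of [T] between
    consecutive iterates gives
    [V_{k+1} - V_k >= (k+1)^2/2 (|D_k|^2 - |e_k|^2)]
    ([halpern_energy_step]), and the Lipschitz bound
    [|e_k| <= eta L |D_k|] makes the right-hand side at least
    [(k+1)^2/2 (1 - eta^2 L^2) |D_k|^2].  Monotonicity between [z_k] and a zero
    [z*] bounds [V_k] by [|z_0 - z*|^2 / 2] ([halpern_energy_le]).  As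
    [V_0 = 0], the errors satisfy
    [\sum_j (j+1)^2 |e_j|^2 <= H_0^2 / (1 - eta^2 L^2)]
    ([FEG_error_sum]), whence
    [|z_{k+1} - w_{k+1}|^2 <= H_0^2 / ((1 - eta^2 L^2) (k+1))]
    ([FEG_OHM_distance]), which is stronger than the announced rate
    because [1/(k+1) <= 1/sqrt(k+1)]. *)

(** * Euclidean inner product *)

Section Euclidean.
Variables (R : realType) (n : nat).
Implicit Types (u v : 'rV[R]_n) (a : R).

Lemma dotv_ge0 u : 0 <= dotv u u.
Proof. by apply: sumr_ge0 => i _; rewrite -expr2 sqr_ge0. Qed.

Lemma enorm_sqr u : enorm u ^+ 2 = dotv u u.
Proof. by rewrite /enorm sqr_sqrtr // dotv_ge0. Qed.

Lemma dotv_sqrZ a u : dotv (a *: u) (a *: u) = a ^+ 2 * dotv u u.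
Proof.
rewrite /dotv mulr_sumr; apply: eq_bigr => i _; rewrite !mxE; ring.
Qed.

Lemma dotvZl a u v : dotv (a *: u) v = a * dotv u v.
Proof.
rewrite /dotv mulr_sumr; apply: eq_bigr => i _; rewrite !mxE; ring.
Qed.

Lemma dotvD_sqr u v : dotv (u + v) (u + v) = dotv u u + 2 * dotv u v + dotv v v.
Proof.
rewrite /dotv !mulr_sumr -!big_split; apply: eq_bigr => i _.
rewrite !mxE /=; ring.
Qed.

(** The two-point case of Jensen's inequality for the square, with weights
    [a / (a + 1)] and [1 / (a + 1)] and denominators cleared. *)
Lemma dotvD_sqr_le a u v : 0 <= a ->
  a * dotv (u + v) (u + v) <= (a + 1) * (dotv u u + a * dotv v v).
Proof.
move=> a0; rewrite -subr_ge0.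
suff -> : (a + 1) * (dotv u u + a * dotv v v) - a * dotv (u + v) (u + v)
        = dotv (u - a *: v) (u - a *: v) by exact: dotv_ge0.
rewrite /dotv mulr_sumr -!big_split !mulr_sumr -sumrN -big_split.
by apply: eq_bigr => i _; rewrite !mxE /=; ring.
Qed.

Lemma elipschitz_sqr L (F : 'rV[R]_n -> 'rV[R]_n) u v : 0 <= L ->
  elipschitz L F ->
  dotv (F u - F v) (F u - F v) <= L ^+ 2 * dotv (u - v) (u - v).
Proof.
move=> L0 /(_ u v) lipF; rewrite -!enorm_sqr -exprMn.
by rewrite ler_sqr // nnegrE ?mulr_ge0 ?sqrtr_ge0.
Qed.

End Euclidean.

(** * Resolvents of monotone operators *)

Section Resolvent.
Variables (R : realType) (n : nat) (eta : R).
Implicit Types (B : operator R n) (F : 'rV[R]_n -> 'rV[R]_n).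

(** With [u] in [B p] and [v] in [B q] the preimages are [p + eta u] and
    [q + eta v]; the cross term of the squared norm of their difference is
    nonnegative by monotonicity. *)
Lemma resolvent_nonexpansive B x y p q : 0 <= eta -> monotone_op B ->
  resolvent eta B x p -> resolvent eta B y q ->
  dotv (p - q) (p - q) <= dotv (x - y) (x - y).
Proof.
move=> eta0 monB [_ [u Bu <-] <-] [_ [v Bv <-] <-].
have -> : id p + eta *: u - (id q + eta *: v) = eta *: (u - v) + (p - q).
  by apply/rowP => i; rewrite !mxE; ring.
rewrite [leRHS]dotvD_sqr (dotvZl _ _ (p - q)) lerDr addr_ge0 ?dotv_ge0 //.
by rewrite !mulr_ge0 // monB.
Qed.

(** A forward step of [F] from a point [y] other than the output [p] turns the
    resolvent of [A] into that of [F + A], up to the mismatch [F p - F y]. *)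
Lemma resolvent_addop F (A : operator R n) x y p :
  resolvent eta A (x - eta *: F y) p ->
  resolvent eta (addop F A) (x + eta *: (F p - F y)) p.
Proof.
case=> _ [b Ab <-] def_x; exists (eta *: (F p + b)).
  by exists (F p + b) => //; exists b.
have -> : x = id p + eta *: b + eta *: F y by rewrite def_x subrK.
by apply/rowP => i; rewrite !mxE; ring.
Qed.

End Resolvent.

(** * The energy of an anchored iteration *)

Section Energy.
Variables (R : realType) (n : nat).
Implicit Types (k : R) (g e d : 'rV[R]_n).

Definition halpern_energy k g z0 z : R :=
  k * @dotv R n g (z0 - z) - k ^+ 2 / 2 * dotv g g.

(** The hypotheses on [z'] and [d] are the anchored step
    [z' = (z0 + k z)/(k + 1) - g' + e] and its gap
    [d = k/(k + 1) g - g' + e] to the half step, cleared of denominators.  The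
    energy increment then equals the right-hand side plus [(k + 1)] times the
    monotonicity term. *)
Lemma halpern_energy_step k z0 z z' g g' e d : 0 <= k ->
  (k + 1) *: z' = z0 + k *: z - (k + 1) *: (g' - e) ->
  (k + 1) *: d = k *: g - (k + 1) *: (g' - e) ->
  0 <= k * dotv (g' - g) (z' - z) ->
  (k + 1) ^+ 2 / 2 * (dotv d d - dotv e e) <=
    halpern_energy (k + 1) g' z0 z' - halpern_energy k g z0 z.
Proof.
move=> k0 def_z' def_d mono.
have -> : z0 = (k + 1) *: z' - k *: z + (k + 1) *: (g' - e).
  by rewrite def_z'; apply/rowP => i; rewrite !mxE; ring.
have -> : (k + 1) ^+ 2 / 2 * (dotv d d - dotv e e)
  = 2^-1 * (dotv ((k + 1) *: d) ((k + 1) *: d) - (k + 1) ^+ 2 * dotv e e).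
  by rewrite dotv_sqrZ; ring.
rewrite def_d -subr_ge0; set inc := (X in 0 <= X).
suff -> : inc = (k + 1) * (k * dotv (g' - g) (z' - z)).
  by rewrite mulr_ge0 // addr_ge0.
rewrite /inc /halpern_energy /dotv.
rewrite !mulr_sumr -!sumrN -!big_split !mulr_sumr -!sumrN -!big_split /=.
by apply: eq_bigr => i _; rewrite !mxE; field.
Qed.

(** With [y] a zero of the operator, monotonicity replaces [z] by [y], and
    completing the square in [k g] leaves the distance from the anchor. *)
Lemma halpern_energy_le k g z0 z y : 0 <= k -> 0 <= dotv g (z - y) ->
  halpern_energy k g z0 z <= dotv (z0 - y) (z0 - y) / 2.
Proof.
move=> k0 mono; rewrite /halpern_energy.
have sq := dotv_ge0 (k *: g - (z0 - y)).
have eq_sq : dotv (k *: g - (z0 - y)) (k *: g - (z0 - y)) =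
    dotv (z0 - y) (z0 - y)
    - 2 * (k * dotv g (z0 - z) + k * dotv g (z - y)) + k ^+ 2 * dotv g g.
  rewrite /dotv !mulr_sumr -!big_split !mulr_sumr -!sumrN -!big_split /=.
  by apply: eq_bigr => i _; rewrite !mxE; ring.
have := mulr_ge0 k0 mono; lra.
Qed.

End Energy.

(** * Composite-FEG as a perturbed OHM *)

Section Comparison.
Variables (R : realType) (n : nat) (eta : R) (F : 'rV[R]_n -> 'rV[R]_n).
Variables (A : operator R n) (z zh c : nat -> 'rV[R]_n).
Hypotheses (eta_gt0 : 0 < eta) (FA_mono : monotone_op (addop F A)).
Hypothesis z_FEG : composite_FEG eta F A z zh c.

Let g k := eta *: (F (z k) + c k).
Let e k := eta *: (F (z k.+1) - F (zh k)).

Let natr1_neq0 k : k%:R + 1 != 0 :> R.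
Proof. by rewrite natr1 pnatr_eq0. Qed.

Lemma FEG_addop k : addop F A (z k.+1) (F (z k.+1) + c k.+1).
Proof.
have [_ /(_ k) [_ [_ [b Ab <-] def_x] ->]] := z_FEG.
exists b => //; congr (_ + _); rewrite -def_x.
by rewrite /= addrC addKr scalerA mulVf ?gt_eqF // scale1r.
Qed.

Lemma FEG_step k :
  (k%:R + 1) *: z k.+1 = z 0%N + k%:R *: z k - (k%:R + 1) *: (g k.+1 - e k).
Proof.
have [_ /(_ k) [_ _ def_c]] := z_FEG.
rewrite /g /e def_c /beta -natr1; apply/rowP => i; rewrite !mxE; field.
by rewrite natr1_neq0 gt_eqF.
Qed.

Lemma FEG_gap k :
  (k%:R + 1) *: (z k.+1 - zh k) = k%:R *: g k - (k%:R + 1) *: (g k.+1 - e k).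
Proof.
rewrite scalerBr FEG_step; have [_ /(_ k) [-> _ _]] := z_FEG.
rewrite /g /beta -natr1; apply/rowP => i; rewrite !mxE; field.
exact: natr1_neq0.
Qed.

Lemma FEG_energy_step k :
  (k%:R + 1) ^+ 2 / 2
    * (dotv (z k.+1 - zh k) (z k.+1 - zh k) - dotv (e k) (e k)) <=
  halpern_energy k.+1%:R (g k.+1) (z 0%N) (z k.+1)
  - halpern_energy k%:R (g k) (z 0%N) (z k).
Proof.
rewrite -(natr1 k); apply: halpern_energy_step => //.
- exact: FEG_step.
- exact: FEG_gap.
(* [c 0 = 0] need not lie in [A (z 0)], but its weight vanishes *)
case: k => [|k]; first by rewrite mul0r.
rewrite /g -scalerBr dotvZl !mulr_ge0 ?(ltW eta_gt0) //.
exact: (FA_mono (FEG_addop k.+1) (FEG_addop k)).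
Qed.

(** Telescoping the energy, which vanishes at [0].  The contribution of [e] is
    absorbed by that of the gap since [eta L < 1], and what is left of the gap
    still dominates [e]. *)
Lemma FEG_error_sum L y k : 0 < L -> elipschitz L F -> eta * L < 1 ->
  zer (addop F A) y ->
  \sum_(j < k) (j%:R + 1) ^+ 2 * dotv (e j) (e j) <=
    dotv (z 0%N - y) (z 0%N - y) / (1 - eta ^+ 2 * L ^+ 2).
Proof.
move=> L0 lipF etaL zy.
have q0 : 0 <= eta ^+ 2 * L ^+ 2 by rewrite mulr_ge0 ?sqr_ge0.
have q1 : eta ^+ 2 * L ^+ 2 < 1.
  by rewrite -exprMn expr_lt1 // mulr_ge0 ?ltW.
set q := _ * _ in q0 q1 *.
case: k => [|k].
  by rewrite big_ord0 divr_ge0 ?dotv_ge0 // subr_ge0 ltW.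
rewrite ler_pdivlMr ?subr_gt0 //.
have energy m : (\sum_(j < m) (j%:R + 1) ^+ 2 * dotv (e j) (e j)) * (1 - q) <=
    2 * halpern_energy m%:R (g m) (z 0%N) (z m).
  elim: m => [|m IHm].
    by rewrite big_ord0 /halpern_energy expr0n !mul0r subr0 mulr0.
  rewrite big_ord_recr /= mulrDl.
  have := FEG_energy_step m; set d := z m.+1 - zh m => step.
  have le_ed : dotv (e m) (e m) <= q * dotv d d.
    rewrite /e dotv_sqrZ /q -[leRHS]mulrA ler_wpM2l ?sqr_ge0 //.
    by apply: elipschitz_sqr lipF; exact: ltW.
  have le_e : dotv (e m) (e m) * (1 - q) <= dotv d d - dotv (e m) (e m).
    (* at [|e|^2 = q |d|^2] this is [(1 - q)^2 >= 0] *)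
    have q2 : 0 <= 2 - q by lra.
    have := mulr_ge0 (dotv_ge0 d) (sqr_ge0 (1 - q)).
    have := ler_wpM2l q2 le_ed; lra.
  have := ler_wpM2l (sqr_ge0 (m%:R + 1 : R)) le_e; lra.
have bound : 0 <= dotv (g k.+1) (z k.+1 - y).
  rewrite /g dotvZl mulr_ge0 ?(ltW eta_gt0) //.
  by have := FA_mono (FEG_addop k) zy; rewrite subr0.
have := halpern_energy_le (z 0%N) (ler0n R k.+1) bound.
have := energy k.+1; lra.
Qed.

Variables w wh : nat -> 'rV[R]_n.
Hypotheses (w_OHM : OHM eta F A w wh) (zw0 : z 0%N = w 0%N).

(** The factor [k] on the right is the Cauchy-Schwarz loss in passing from the
    sum of the errors to the sum of their squares. *)
Lemma FEG_OHM_drift k :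
  k%:R ^+ 2 * dotv (z k - w k) (z k - w k) <=
    k%:R * \sum_(j < k) (j%:R + 1) ^+ 2 * dotv (e j) (e j).
Proof.
elim: k => [|k IHk]; first by rewrite expr0n !mul0r.
rewrite big_ord_recr /= -[in leLHS]natr1 -[k.+1%:R in leRHS]natr1.
have [def_wh w_res] := w_OHM k.
have [_ /(_ k) [_ /resolvent_addop z_res _]] := z_FEG.
have contr := resolvent_nonexpansive (ltW eta_gt0) FA_mono z_res w_res.
have := ler_wpM2l (sqr_ge0 (k%:R + 1 : R)) contr; move/le_trans; apply.
rewrite -[leLHS]dotv_sqrZ.
have -> : (k%:R + 1) *: (beta R k *: z 0%N + (1 - beta R k) *: z k
    + eta *: (F (z k.+1) - F (zh k)) - wh k)
  = k%:R *: (z k - w k) + (k%:R + 1) *: e k.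
  rewrite def_wh zw0 /e /beta -natr1; apply/rowP => i; rewrite !mxE; field.
  exact: natr1_neq0.
rewrite -(dotv_sqrZ _ (e k)).
set p := k%:R *: (z k - w k); set r := _ *: e k.
move: IHk; rewrite -dotv_sqrZ -/p; set S := \sum_(j < k) _ => IHk.
case: k {def_wh w_res z_res contr} @p @r @S IHk => [|k] p r S IHk.
  rewrite /p /S scale0r !add0r big_ord0 add0r mul1r //.
have k0 : (0 : R) < k.+1%:R by rewrite ltr0n.
rewrite -(ler_pM2l k0); apply: (le_trans (dotvD_sqr_le _ _ (ltW k0))).
rewrite [leRHS]mulrCA ler_wpM2l ?addr_ge0 // mulrDr lerD2r.
exact: IHk.
Qed.

Lemma FEG_OHM_distance L y k : 0 < L -> elipschitz L F -> eta * L < 1 ->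
  zer (addop F A) y ->
  dotv (z k.+1 - w k.+1) (z k.+1 - w k.+1) <=
    dotv (z 0%N - y) (z 0%N - y) / (1 - eta ^+ 2 * L ^+ 2) / k.+1%:R.
Proof.
move=> L0 lipF etaL zy.
have k0 : (0 : R) < k.+1%:R by rewrite ltr0n.
have := FEG_OHM_drift k.+1.
rewrite expr2 -mulrA ler_pM2l // => drift.
rewrite ler_pdivlMr // mulrC; apply: (le_trans drift).
exact: FEG_error_sum.
Qed.

End Comparison.

(** * The rate *)

Theorem theorem4p6 (R : realType) (n : nat) (L : R) (L_gt0 : 0 < L)
    (F : 'rV[R]_n -> 'rV[R]_n) (F_lip : elipschitz L F)
    (A : operator R n) (A_max : maximal_monotone_op A)
    (FA_mono : monotone_op (addop F A))
    (zer_neq0 : zer (addop F A) !=set0)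
    (eta : R) (eta_gt0 : 0 < eta) (eta_lt : eta < 1 / L)
    (z zh c : nat -> 'rV[R]_n) (z_FEG : composite_FEG eta F A z zh c)
    (w wh : nat -> 'rV[R]_n) (w_OHM : OHM eta F A w wh)
    (zw0 : z 0%N = w 0%N)
    (H0 : R)
    (H0_min : is_min [set enorm (z 0%N - zs) ^+ 2 | zs in zer (addop F A)]
                     (H0 ^+ 2)) :
  forall k : nat, (1 <= k)%N ->
    enorm (z k.+1 - w k.+1) ^+ 2 <=
      H0 ^+ 2 / (1 - eta ^+ 2 * L ^+ 2) *
      (24%:R / Num.sqrt k.+1%:R + 36%:R / k.+1%:R ^+ 2).
Proof.
move=> k _; have [[y zy <-] _] := H0_min.
have etaL : eta * L < 1 by rewrite -ltr_pdivlMr.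
rewrite !enorm_sqr.
have := FEG_OHM_distance eta_gt0 FA_mono z_FEG w_OHM zw0 k L_gt0 F_lip etaL zy.
move/le_trans; apply; apply: ler_wpM2l.
  rewrite divr_ge0 ?dotv_ge0 // subr_ge0 -exprMn.
  by rewrite exprn_ile1 ?mulr_ge0 ?ltW.
set N : R := k.+1%:R.
have N1 : 1 <= N by rewrite ler1n.
have sN1 : 1 <= Num.sqrt N by rewrite -[leLHS]sqrtr1 ler_wsqrtr.
have N0 : 0 < N by exact: lt_le_trans N1.
have sN0 : 0 < Num.sqrt N by exact: lt_le_trans sN1.
have le_sN : Num.sqrt N <= N.
  by rewrite -[leRHS](sqr_sqrtr (ltW N0)) expr2 ler_peMl ?(ltW sN0).
have le_inv : N^-1 <= (Num.sqrt N)^-1 by rewrite lef_pV2 ?posrE.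
have inv0 : 0 <= (N ^+ 2)^-1 by rewrite invr_ge0 sqr_ge0.
have sinv0 : 0 <= (Num.sqrt N)^-1 by rewrite invr_ge0 ltW.
apply: (le_trans le_inv); rewrite -[leLHS]addr0 lerD ?mulr_ge0 //.
by rewrite ler_peMl // ler1n.
Qed.
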